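(* Let $(R,\mathfrak m)$ be a Noetherian local ring of dimension $d\ge1$, let $J$ be an $\mathfrak m$-primary ideal, and let $I=(J,h_1,\dots,h_m)$ with $h_1,\dots,h_m\in R$ integral over $J$, and let $s=\operatorname{red}_J(I)$. Then \[ e_1(I)-e_1(J)\le \lambda\big(R/(J:I)\big)\cdot\left[\binom{m+s}{s}-1\right]\cdot f_0(J). \]
   Context: $\lambda$ denotes length. For an $\mathfrak m$-primary ideal $K$, the Hilbert coefficients $e_i(K)$ are the integers with $\lambda(R/K^{n+1})=\sum_{i=0}^{d}(-1)^i e_i(K)\binom{n+d-i}{d-i}$ for $n\gg0$. $f_0(K)$ is the multiplicity of the special fiber ring $\bigoplus_{n\ge0}K^n/\mathfrak mK^n$, i.e. $\nu(K^n)=f_0(K)\binom{n+d-1}{d-1}+(\text{lower order terms})$ for $n\gg0$, where $\nu$ is minimal number of generators. Since $I$ is integral over $J$, $J$ is a reduction of $I$, and $\operatorname{red}_J(I)$ is the least $s\ge0$ with $I^{s+1}=JI^s$. $J:I=\{r\in R: rI\subseteq J\}$. *)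

(* Defs.v *)
From HB Require Import structures.
From mathcomp Require Import all_boot all_order all_algebra.
Set Implicit Arguments. Unset Strict Implicit. Unset Printing Implicit Defensive.
Import Order.TTheory GRing.Theory Num.Theory.
Local Open Scope ring_scope.

Section CommAlg.
Variable R : comUnitRingType.

Definition ideal (K : R -> Prop) : Prop :=
  K 0 /\ (forall x y, K x -> K y -> K (x + y)) /\ (forall r x, K x -> K (r * x)).

Definition eqI (A B : R -> Prop) : Prop := forall x, A x <-> B x.
Definition subI (A B : R -> Prop) : Prop := forall x, A x -> B x.
Definition ssubI (A B : R -> Prop) : Prop := subI A B /\ exists x, B x /\ ~ A x.

Definition gen (S : R -> Prop) : R -> Prop :=
  fun x => forall K, ideal K -> subI S K -> K x.

Definition prodI (A B : R -> Prop) : R -> Prop :=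
  gen (fun x => exists a b, A a /\ B b /\ x = a * b).

Fixpoint powI (K : R -> Prop) (n : nat) : R -> Prop :=
  match n with
  | 0%N => fun _ => True
  | n'.+1 => prodI K (powI K n')
  end.

Definition colon (J I : R -> Prop) : R -> Prop := fun r => forall y, I y -> J (r * y).

Definition prime_ideal (P : R -> Prop) : Prop :=
  ideal P /\ ~ P 1 /\ (forall a b, P (a * b) -> P a \/ P b).

Definition noetherian : Prop :=
  forall c : nat -> R -> Prop, (forall n, ideal (c n)) ->
    (forall n, subI (c n) (c n.+1)) ->
    exists N, forall n, (N <= n)%N -> subI (c n) (c N).

Definition local_ring (mm : R -> Prop) : Prop :=
  ideal mm /\ ~ mm 1 /\ (forall x, ~ mm x -> x \is a GRing.unit).

Definition prime_chain (l : nat) : Prop :=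
  exists P : nat -> R -> Prop, (forall i, (i <= l)%N -> prime_ideal (P i)) /\
    (forall i, (i < l)%N -> ssubI (P i) (P i.+1)).

Definition krull_dim (d : nat) : Prop := prime_chain d /\ ~ prime_chain d.+1.

Definition primary_to (mm K : R -> Prop) : Prop :=
  ideal K /\ ~ K 1 /\ (forall x, mm x <-> exists n, K (x ^+ n)).

Definition ideal_chain (K : R -> Prop) (l : nat) : Prop :=
  exists c : nat -> R -> Prop, (forall i, (i <= l)%N -> ideal (c i)) /\
    eqI (c 0%N) K /\ eqI (c l) (fun _ => True) /\
    (forall i, (i < l)%N -> ssubI (c i) (c i.+1)).

(* lambda(R/K) = l : composition length of the R-module R/K
   (submodules of R/K = ideals containing K) *)
Definition length_quot (K : R -> Prop) (l : nat) : Prop :=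
  ideal_chain K l /\ ~ ideal_chain K l.+1.

Definition gen_by (K : R -> Prop) (k : nat) : Prop :=
  exists g : 'I_k -> R, eqI K (gen (fun x => exists i, x = g i)).

Definition num_gens (K : R -> Prop) (k : nat) : Prop :=
  gen_by K k /\ forall k', (k' < k)%N -> ~ gen_by K k'.

Definition integral_over (J : R -> Prop) (h : R) : Prop :=
  exists k : nat, exists a : nat -> R, (0 < k)%N /\
    (forall i, (1 <= i <= k)%N -> powI J i (a i)) /\
    h ^+ k + \sum_(i < k) a i.+1 * h ^+ (k - i.+1) = 0.

Definition red_number (J I : R -> Prop) (s : nat) : Prop :=
  eqI (powI I s.+1) (prodI J (powI I s)) /\
  forall s', (s' < s)%N -> ~ eqI (powI I s'.+1) (prodI J (powI I s')).

Definition hilbert_coeffs (d : nat) (K : R -> Prop) (e : nat -> int) : Prop :=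
  exists N, forall n, (N <= n)%N -> exists l : nat,
    length_quot (powI K n.+1) l /\
    (l%:Z = \sum_(i < d.+1) (-1) ^+ i * e i * ('C(n + d - i, d - i))%:Z).

(* f0 is the multiplicity of the special fiber ring of K:
   nu(K^n) = f0 * C(n+d-1, d-1) + (polynomial in n of degree <= d-2) for n >> 0 *)
Definition fiber_mult (d : nat) (K : R -> Prop) (f0 : nat) : Prop :=
  exists p : {poly rat}, (size p <= d.-1)%N /\
  exists N, forall n, (N <= n)%N -> exists k : nat,
    num_gens (powI K n) k /\
    (k%:R = f0%:R * ('C(n + d.-1, d.-1))%:R + p.[n%:R] :> rat).

Definition adjoin (J : R -> Prop) (m : nat) (h : 'I_m -> R) : R -> Prop :=
  gen (fun x => J x \/ exists i, x = h i).

End CommAlg.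

(* Main.v *)
(* Put I = (J, h_1, ..., h_m) and F_k = J^(n-k) I^k, so F_0 = J^n and F_s = I^n
   for n >= s. The quotient F_k / F_(k-1) is killed by J : I and is generated by
   the products of generators of J^(n-k) with the degree k monomials in the h_i.
   Hence length(I^n / J^n) <= length(R / (J : I)) * sum_(1 <= k <= s)
   nu(J^(n-k)) C(m+k-1, k), where the right-hand side grows like
   length(R / (J : I)) (C(m+s, s) - 1) f_0(J) n^(d-1) / (d-1)!.
   Since 0 <= length(I^n / J^n), comparing coefficients of n^d gives
   e_0(I) = e_0(J), and comparing coefficients of n^(d-1) gives the claim. *)
Require Import Defs.
From HB Require Import structures.
From mathcomp Require Import all_boot all_order all_algebra.
From mathcomp Require Import boolp.
From mathcomp Require Import zify ring lra.
Import Order.TTheory GRing.Theory Num.Theory.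
Local Open Scope ring_scope.

(** * Products, sums, colons and simple extensions of ideals *)

Section Ideals.
Set Implicit Arguments. Unset Strict Implicit. Unset Printing Implicit Defensive.
Variable R : comUnitRingType.
Implicit Types (A B I J K q : R -> Prop) (c : nat -> R -> Prop) (g x y : R).

Lemma ideal_gen (S : R -> Prop) : ideal (gen S).
Proof.
split; [|split] => [K [K0 _] _ //|x y gx gy K hK sK|r x gx K hK sK].
  by case: (hK) => _ [KD _]; apply: KD; [apply: gx|apply: gy].
by case: (hK) => _ [_ KM]; apply: KM; apply: gx.
Qed.

Lemma ideal_prodI A B : ideal (prodI A B).
Proof. exact: ideal_gen. Qed.

Lemma ideal_powI K n : ideal (powI K n).
Proof. by case: n => [|n] //=; apply: ideal_gen. Qed.

Lemma prodI_mul {A B} x y : A x -> B y -> prodI A B (x * y).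
Proof. by move=> Ax By K _; apply; exists x, y. Qed.

Lemma ideal_mulr {K} r x : ideal K -> K x -> K (x * r).
Proof. by case=> _ [_ KM] Kx; rewrite mulrC; apply: KM. Qed.

Lemma ideal_colon1 {K} x : ideal K -> ideal (fun r => K (r * x)).
Proof.
case=> K0 [KD KM]; split; [|split] => [|a b|r a]; first by rewrite mul0r.
  by rewrite mulrDl; apply: KD.
by rewrite -mulrA; apply: KM.
Qed.

Lemma prodI_le {A B K} : ideal K ->
  (forall x y, A x -> B y -> K (x * y)) -> subI (prodI A B) K.
Proof. by move=> hK h x; apply=> // _ [a [b [Aa [Bb ->]]]]; apply: h. Qed.

Definition addI A B x := exists a b, [/\ A a, B b & x = a + b].

Lemma ideal_addI A B : ideal A -> ideal B -> ideal (addI A B).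
Proof.
move=> [A0 [AD AM]] [B0 [BD BM]]; split; [|split].
- by exists 0, 0; rewrite addr0.
- move=> _ _ [a [b [Aa Bb ->]]] [a' [b' [Aa' Bb' ->]]].
  exists (a + a'), (b + b'); split; [exact: AD|exact: BD|by rewrite addrACA].
- move=> r _ [a [b [Aa Bb ->]]]; exists (r * a), (r * b).
  by rewrite mulrDr; split; [exact: AM|exact: BM|].
Qed.

Definition adjoin1 A g x := exists a r, A a /\ x = a + r * g.

Lemma ideal_adjoin1 A g : ideal A -> ideal (adjoin1 A g).
Proof.
move=> [A0 [AD AM]]; split; [|split].
- by exists 0, 0; rewrite mul0r addr0.
- move=> _ _ [a [r [Aa ->]]] [b [t [Ab ->]]].
  by exists (a + b), (r + t); rewrite mulrDl addrACA; split=> //; apply: AD.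
- move=> u _ [a [r [Aa ->]]]; exists (u * a), (u * r).
  by rewrite mulrDr mulrA; split=> //; apply: AM.
Qed.

Lemma sub_adjoin1 A g : subI A (adjoin1 A g).
Proof. by move=> a Aa; exists a, 0; rewrite mul0r addr0. Qed.

(** * Length bounds through chains of ideals *)

Definition len_le K l := ~ ideal_chain K l.+1.

(** Keep the top of the chain and replace its lowest [l - l' + 1] terms by [K']. This is why
    excluding the single length [l.+1] in [len_le] bounds all chains. *)
Lemma ideal_chain_shorten K K' l l' : ideal K' -> subI K' K ->
  (0 < l' <= l)%N -> ideal_chain K l -> ideal_chain K' l'.
Proof.
move=> hK' sK /andP[l'0 l'l] [c [ci [c0 [cl cs]]]].
have c0i k : (k <= l)%N -> subI K (c k).
  elim: k => [_ x|k IH kl x Kx]; first by move/c0.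
  by have [+ _] := cs k kl; apply; apply: IH => //; apply: ltnW.
exists (fun i => if i is 0 then K' else c (i + (l - l'))%N); split; [|split; [|split]].
- by case=> // i il; apply: ci; lia.
- by [].
- case: l' l'0 l'l => // l' _ l'l; rewrite subnKC //.
- case=> [_|i il]; last by rewrite addSn; apply: cs; lia.
  rewrite add1n; have kl : (l - l' < l)%N by lia.
  have [s1 [x [cx ncx]]] := cs _ kl.
  split; first by move=> y /sK Ky; apply: s1; apply: c0i => //; lia.
  by exists x; split=> // /sK Kx; apply: ncx; apply: c0i => //; lia.
Qed.

Lemma len_le_sub K K' l : ideal K -> subI K K' -> len_le K l -> len_le K' l.
Proof.
move=> hK sK hl hc; apply: hl.
by apply: ideal_chain_shorten hc => //; rewrite ltnSn.
Qed.

Lemma ideal_chain_le K l l' : ideal K -> len_le K l -> ideal_chain K l' -> (l' <= l)%N.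
Proof.
move=> hK hl hc; rewrite leqNgt; apply/negP => lt; apply: hl.
by apply: ideal_chain_shorten hc => //; rewrite lt.
Qed.

Definition proper_step c i := `[< ~ subI (c i.+1) (c i) >].

(** Discards repetitions from a weakly increasing chain: the last term is appended only if its step
    is proper, and otherwise equals the previous one by extensionality. *)
Lemma strict_subchain c N : (forall i, (i <= N)%N -> ideal (c i)) ->
    (forall i, (i < N)%N -> subI (c i) (c i.+1)) ->
  exists e, [/\ forall i, ideal (e i), e 0%N = c 0%N,
    e (\sum_(i < N) proper_step c i)%N = c N &
    forall i, (i < \sum_(j < N) proper_step c j)%N -> ssubI (e i) (e i.+1)].
Proof.
elim: N => [|N IH] ci cs.
  by exists (fun=> c 0%N); rewrite big_ord0; split=> // i; apply: ci.
have [||e [ei e0 eN es]] := IH; [by move=> i /leqW/ci|by move=> i /ltnW/cs|].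
rewrite big_ord_recr /=; set k := (\sum_(i < N) _)%N in eN es *.
rewrite /proper_step; case: asboolP => st; last first.
  rewrite addn0; exists e; split=> //; rewrite eN.
  apply/funext => x; apply/propext; split; first exact: cs.
  by move: x; apply: contrapT.
exists (fun i => if (i <= k)%N then e i else c N.+1); split.
- by move=> i; case: ifP => // _; apply: ci.
- by rewrite leq0n.
- by rewrite addn1 ltnn.
- move=> i; rewrite addn1 ltnS leq_eqVlt => /orP[/eqP->|ik]; last first.
    by rewrite /= ik orbT; apply: es.
  rewrite /= eqxx ltnn eN; split; first exact: cs.
  apply: contrapT => H; apply: st => x cx; apply: contrapT => ncx.
  by apply: H; exists x.
Qed.

Lemma proper_steps_le K c N l : ideal K -> len_le K l -> subI K (c 0%N) ->
    (forall i, (i <= N)%N -> ideal (c i)) ->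
    (forall i, (i < N)%N -> subI (c i) (c i.+1)) -> (forall x, c N x) ->
  (\sum_(i < N) proper_step c i <= l)%N.
Proof.
move=> hK hl K0 ci cs cN; have [e [ei e0 eN es]] := strict_subchain ci cs.
apply: (@ideal_chain_le (c 0%N)); first exact: ci.
  exact: len_le_sub hl.
by exists e; split=> //; rewrite e0 eN; split=> // x; split.
Qed.

(* A step of a chain above [A] is proper modulo [A + (g)] or proper after
   taking colons by [g]; the colons by [g] contain [q]. *)
Lemma len_le_adjoin1 A q g l L : ideal A -> ideal q ->
    (forall r, q r -> A (r * g)) -> len_le q l -> len_le (adjoin1 A g) L ->
  len_le A (L + l)%N.
Proof.
move=> hA hq qg hl hL [c [ci [c0 [cN cs]]]].
set N := (L + l).+1 in ci cN cs.
have hB := ideal_adjoin1 g hA.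
have cm i : (i < N)%N -> subI (c i) (c i.+1) by move=> /cs[].
have A0 i : (i <= N)%N -> subI A (c i).
  elim: i => [_ x /c0 //|i IH iN x Ax].
  by apply: cm => //; apply: IH => //; apply: ltnW.
(* The two weak chains: colons by [g], bounded by [l], then sums with [A + (g)], bounded by [L]. *)
have h1 : (\sum_(i < N) proper_step (fun i r => c i (r * g)%R) i <= l)%N.
  apply: (proper_steps_le hq hl) => [r qr|i iN|i iN r|r].
  - by apply: A0 => //; apply: qg.
  - exact/ideal_colon1/ci.
  - exact: cm.
  - exact/cN.
have h2 : (\sum_(i < N) proper_step (fun i => addI (c i) (adjoin1 A g)) i <= L)%N.
  apply: (proper_steps_le hB hL) => [x Bx|i iN|i iN x|x].
  - by exists 0, x; rewrite add0r; split=> //; case: (ci 0%N).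
  - by apply: ideal_addI => //; apply: ci.
  - by case=> [a [b [ca Bb ->]]]; exists a, b; split=> //; apply: cm.
  - by exists x, 0; rewrite addr0; split=> //; [exact/cN|case: hB].
(* It remains to see that each of the [L + l + 1] strict steps is proper in at least one of the two
   chains. *)
have := leq_add h2 h1; rewrite -big_split /=; apply/negP; rewrite -ltnNge.
suff : (N <= \sum_(i < N) (proper_step (fun i => addI (c i) (adjoin1 A g)) i +
     proper_step (fun i r => c i (r * g)%R) i))%N by [].
rewrite -[X in (X <= _)%N]card_ord -sum1_card; apply: leq_sum => i _.
rewrite /proper_step; case: asboolP => // /contrapT s1.
case: asboolP => // /contrapT s2; exfalso.
(* If both steps are trivial, write a new element as [x = a + a' + r * g] with [a] in [c i] and [a']
   in [A]. Then [r * g] lies in [c i.+1], hence in [c i] by triviality of the colon step, and so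
   does [x]. *)
have [_ [x [cx ncx]]] := cs i (ltn_ord i); apply: ncx.
have [|a [b [ca [a' [r [Aa' eb]]] ex]]] := s1 x.
  by exists x, 0; rewrite addr0; split=> //; case: hB.
have [_ [cD cM]] := ci i (ltnW (ltn_ord i)).
have ca' : c i a' by apply: A0 => //; apply: ltnW.
rewrite ex eb; apply: (cD) => //; apply: (cD) => //; apply: (s2 r).
have [_ [cD' cM']] := ci i.+1 (ltn_ord i).
have -> : r * g = x + (-1) * (a + a') by rewrite {}ex {}eb; ring.
by apply: (cD') => //; apply: cM'; apply: cD'; apply: cm.
Qed.

Definition adjoins A (gs : seq R) := foldr (fun g B => adjoin1 B g) A gs.

Lemma ideal_adjoins A gs : ideal A -> ideal (adjoins A gs).
Proof. by move=> hA; elim: gs => //= g gs; apply: ideal_adjoin1. Qed.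

Lemma sub_adjoins A gs : subI A (adjoins A gs).
Proof. by elim: gs => //= g gs IH x /IH; apply: sub_adjoin1. Qed.

Lemma mem_adjoins A gs g : ideal A -> g \in gs -> adjoins A gs g.
Proof.
move=> hA; elim: gs => //= k gs IH; rewrite inE => /orP[/eqP->|/IH].
  by exists 0, 1; rewrite add0r mul1r; split=> //; case: (ideal_adjoins gs hA).
exact: sub_adjoin1.
Qed.

(** Each adjoined generator gives a cyclic quotient killed by [q], which costs at most [l]. *)
Lemma len_le_adjoins A q gs l L : ideal A -> ideal q ->
    (forall r g, q r -> g \in gs -> A (r * g)) -> len_le q l ->
    len_le (adjoins A gs) L ->
  len_le A (L + l * size gs)%N.
Proof.
move=> hA hq + hl; elim: gs L => [|g gs IH] L qg /=; first by rewrite muln0 addn0.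
move=> hL; rewrite mulnS addnA; apply: IH.
  by move=> r k qr ks; apply: qg => //; rewrite inE ks orbT.
apply: (len_le_adjoin1 _ hq) hL => //; first exact: ideal_adjoins.
by move=> r qr; apply: sub_adjoins; apply: qg => //; rewrite inE eqxx.
Qed.

(** * Counting monomials *)

(* The degree [k] monomials in the entries of [hs], with repetitions. *)
Fixpoint monomials (hs : seq R) (k : nat) {struct hs} : seq R :=
  match hs with
  | [::] => nseq (k == 0%N) 1
  | h :: hs' => (fix mons k := match k with
      | 0%N => [:: 1]
      | k'.+1 => monomials hs' k'.+1 ++ [seq h * x | x <- mons k']
      end) k
  end.

Lemma monomials0 hs : monomials hs 0 = [:: 1].
Proof. by case: hs. Qed.

Lemma monomials_cons h hs k : monomials (h :: hs) k.+1 =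
  monomials hs k.+1 ++ [seq h * x | x <- monomials (h :: hs) k].
Proof. by []. Qed.

(** Pascal's rule. Stating it for a nonempty list avoids the subtraction in C(m+k-1, k). *)
Lemma size_monomials h hs k : size (monomials (h :: hs) k) = 'C(size hs + k, k).
Proof.
elim: hs h k => [|h' hs IH] h; elim=> [|k IHk]; rewrite ?monomials0 ?bin0 //.
  by rewrite monomials_cons size_cat size_map IHk /= !add0n !binn.
by rewrite monomials_cons size_cat size_map IH IHk addnS /= addnS addSn binS.
Qed.

(** Homogenization: monomials of degree at most [s] in [hs] correspond to those of degree [s] in one
    more variable, here given the value 0 since only sizes matter. *)
Lemma size_monomials_sum hs s :
  (\sum_(k < s.+1) size (monomials hs k))%N = 'C(size hs + s, s).
Proof.
rewrite -(size_monomials 0); elim: s => [|s IH]; first by rewrite big_ord1 !monomials0.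
by rewrite big_ord_recr IH monomials_cons size_cat size_map addnC.
Qed.

Lemma adjoin_le m (h : 'I_m -> R) J K : ideal K -> subI J K ->
  (forall i, K (h i)) -> subI (adjoin J h) K.
Proof. by move=> hK JK hh x; apply=> // y [/JK|[i ->]]. Qed.

Lemma powI_le I J n : subI I J -> subI (powI I n) (powI J n).
Proof.
move=> IJ; elim: n => // n IH; apply: prodI_le => [|x y Ix Iy].
  exact: ideal_prodI.
by apply: prodI_mul; [apply: IJ|apply: IH].
Qed.

Lemma gen_le (S : R -> Prop) K : ideal K -> subI S K -> subI (gen S) K.
Proof. by move=> hK SK x; apply. Qed.

Lemma monomials_powI (gs : seq R) I k y : (forall g, g \in gs -> I g) ->
  y \in monomials gs k -> powI I k y.
Proof.
elim: gs k y => [[]|g gs IH] // k y gI.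
elim: k y => // k IHk y; rewrite monomials_cons mem_cat => /orP[|/mapP[x xm ->]].
  by apply: IH => x xgs; apply: gI; rewrite inE xgs orbT.
by apply: prodI_mul; [apply: gI; rewrite inE eqxx|apply: IHk].
Qed.

(** * The filtration of I^n by the ideals J^(n-k) I^k *)

Section Filtration.
Variables (J : R -> Prop) (m : nat) (h : 'I_m -> R).
Hypothesis idealJ : ideal J.
Let I := adjoin J h.
Let hs := [seq h i | i <- enum 'I_m].

Lemma mem_hs i : h i \in hs.
Proof. by apply: map_f; rewrite mem_enum. Qed.

Lemma monomials_mul g (gs : seq R) k x : g \in gs -> x \in monomials gs k ->
  g * x \in monomials gs k.+1.
Proof.
elim: gs k x => // g' gs IH k x; rewrite inE monomials_cons mem_cat.
case/orP=> [/eqP->|ggs]; first by move=> xm; rewrite map_f ?orbT.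
elim: k x => [|k IHk] x.
  by rewrite monomials0 inE => /eqP->; rewrite IH // monomials0 inE.
rewrite monomials_cons mem_cat => /orP[xm|]; first by rewrite IH.
case/mapP=> y ym ->; rewrite mulrCA; have := IHk y ym.
by rewrite -mem_cat -monomials_cons => /(map_f ( *%R g')) ->; rewrite orbT.
Qed.

(** Says that the degree [k] monomials generate I^k modulo J I^(k-1). Testing against an arbitrary
    ideal [K] lets the induction pass to the colon of [K] by [h i]. *)
Lemma powI_adjoin_le K k : ideal K -> (forall x, x \in monomials hs k -> K x) ->
    (forall k', k = k'.+1 -> subI (prodI J (powI I k')) K) -> subI (powI I k) K.
Proof.
elim: k K => [|k IH] K hK mK JK.
  move=> x _; rewrite -[x]mulr1; case: (hK) => _ [_]; apply; apply: mK.
  by rewrite monomials0 inE.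
apply: prodI_le => // x y Ix Iy; move: x Ix.
apply: adjoin_le => [|x Jx|i]; first exact: ideal_colon1.
  by apply: (JK k) => //; apply: prodI_mul.
suff : subI (powI I k) (fun y => K (y * h i)) by rewrite mulrC; apply.
apply: IH => [|x xm|k' ek]; first exact: ideal_colon1.
  by rewrite mulrC; apply/mK/monomials_mul => //; apply: mem_hs.
subst k; apply: prodI_le => [|u v Ju Iv]; first exact: ideal_colon1.
rewrite -mulrA; apply: (JK _ erefl); apply: prodI_mul => //.
rewrite mulrC; apply: prodI_mul => //.
by move=> L hL; apply; right; exists i.
Qed.

(** Each further factor from I is absorbed into I^s, and the reduction equation trades it for a
    factor from J. *)
Lemma powI_red a s : subI (powI I s.+1) (prodI J (powI I s)) ->
  subI (powI I (s + a)) (prodI (powI J a) (powI I s)).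
Proof.
move=> red; elim: a => [|a IH].
  by rewrite addn0 => x Ix; rewrite -[x]mul1r; apply: prodI_mul.
rewrite addnS; set K := prodI (powI J a.+1) _.
have hK : ideal K by apply: ideal_prodI.
apply: prodI_le => // x y Ix /IH; rewrite mulrC; move: y.
apply: prodI_le => [|u v Ju Iv]; first exact: ideal_colon1.
have : powI I s.+1 (v * x) by rewrite mulrC; apply: prodI_mul.
rewrite -mulrA; move/red; rewrite mulrC; move: (v * x).
apply: prodI_le => [|j w Jj Iw]; first exact: ideal_colon1.
rewrite mulrAC; apply: prodI_mul => //; exact: prodI_mul.
Qed.

(** One filtration step. Generators of J^a times monomials of degree [k.+1] generate the quotient,
    and an element of J : I kills it by turning a factor from I into one from J. *)
Lemma gen_powI_step a k n l L : gen_by (powI J a) n -> len_le (colon J I) l ->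
    len_le (prodI (powI J a) (powI I k.+1)) L ->
  len_le (prodI (powI J a.+1) (powI I k)) (L + l * (n * size (monomials hs k.+1)))%N.
Proof.
move=> [g gE] hl hL.
pose gs := [seq x * y | x <- [seq g i | i <- enum 'I_n], y <- monomials hs k.+1].
have -> : (n * size (monomials hs k.+1))%N = size gs.
  by rewrite size_allpairs size_map size_enum_ord.
set A := prodI _ _; have hA : ideal A by apply: ideal_prodI.
have gJ i : powI J a (g i) by apply/gE => K _; apply; exists i.
have JJI x y : powI J a x -> prodI J (powI I k) y -> A (y * x).
  move=> Jx; move: y; apply: prodI_le => [|u v Ju Iv]; first exact: ideal_colon1.
  by rewrite mulrAC; apply: prodI_mul => //; apply: prodI_mul.
apply: (@len_le_adjoins _ (colon J I)) hl _ => //.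
- case: idealJ => J0 [JD JM]; split; [|split].
  + by move=> y _; rewrite mul0r.
  + by move=> x y qx qy z Iz; rewrite mulrDl; apply: JD; [apply: qx|apply: qy].
  + by move=> r x qx y Iy; rewrite -mulrA; apply/JM/qx.
- move=> r _ qr /allpairsP[[x y] /= [/mapP[i _ ->] ym ->]].
  rewrite mulrCA mulrC; apply: JJI => //; rewrite mulrC.
  have : powI I k.+1 y.
    by apply: monomials_powI ym => _ /mapP[j _ ->] K _; apply; right; exists j.
  move: y {ym}; apply: prodI_le => [|u v Iu Iv]; first exact/ideal_colon1/ideal_prodI.
  by rewrite mulrC mulrA; apply: prodI_mul => //; apply: qr.
- apply: len_le_sub hL; first exact: ideal_prodI.
  have hB := ideal_adjoins gs hA.
  apply: prodI_le => // x y Jx; rewrite mulrC; move: y.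
  apply: powI_adjoin_le => [|y ym|_ [<-] y JIy]; first exact: ideal_colon1.
    rewrite mulrC; move/gE: Jx; move: x.
    apply: gen_le => [|_ [i ->]]; first exact: ideal_colon1.
    by apply: mem_adjoins => //; apply: allpairs_f => //; rewrite map_f ?mem_enum.
  by apply: sub_adjoins; apply: JJI.
Qed.

(** Telescopes the steps: summand [j] compares J^(a+k-j-1) I^(j+1) with J^(a+k-j) I^j. *)
Lemma len_le_powI l k a L (nu : nat -> nat) : len_le (colon J I) l ->
    (forall b, (a <= b)%N -> gen_by (powI J b) (nu b)) ->
    len_le (prodI (powI J a) (powI I k)) L ->
  len_le (powI J (a + k))
    (L + l * \sum_(j < k) nu (a + k - j.+1) * size (monomials hs j.+1))%N.
Proof.
move=> hl; elim: k a L => [|k IH] a L gJ hL.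
  rewrite big_ord0 muln0 !addn0; apply: len_le_sub hL; first exact: ideal_prodI.
  by apply: prodI_le => [|x y Jx _]; last apply: ideal_mulr => //; apply: ideal_powI.
rewrite big_ord_recr /= addnK mulnDr [(l * _ + _)%N]addnC addnA -addSnnS.
apply: IH => [b ab|]; first exact/gJ/ltnW.
by apply: gen_powI_step => //; apply: gJ.
Qed.

Lemma length_powI_adjoin_le l s n lI lJ (nu : nat -> nat) :
    len_le (colon J I) l -> subI (powI I s.+1) (prodI J (powI I s)) -> (s <= n)%N ->
    (forall b, (n - s <= b)%N -> gen_by (powI J b) (nu b)) ->
    length_quot (powI I n) lI -> length_quot (powI J n) lJ ->
  (lI <= lJ <= lI + l * \sum_(j < s) nu (n - j.+1) * size (monomials hs j.+1))%N.
Proof.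
move=> hl red sn gJ [cI hI] [cJ hJ]; apply/andP; split.
  apply: ideal_chain_le cI; first exact: ideal_powI.
  apply: len_le_sub hJ; first exact: ideal_powI.
  by apply: powI_le => x Jx K _; apply; left.
apply: ideal_chain_le cJ; first exact: ideal_powI.
rewrite -[in powI J n](subnK sn) -[in \sum_(j < s) _](subnK sn).
apply: len_le_powI => //; apply: len_le_sub hI; first exact: ideal_powI.
by rewrite -[n in powI I n](subnKC sn); apply: powI_red.
Qed.

End Filtration.
End Ideals.

(** * Leading coefficients of eventually polynomial functions *)

Section Growth.
Set Implicit Arguments. Unset Strict Implicit. Unset Printing Implicit Defensive.
Implicit Types (u v : nat -> rat) (p : {poly rat}).

Lemma coef_ge0 p k N : (size p <= k.+1)%N ->
  (forall n, (N <= n)%N -> 0 <= p.[n%:R]) -> 0 <= p`_k.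
Proof.
move=> sp p0; rewrite leNgt; apply/negP => pk.
set C := \sum_(i < k) `|p`_i|.
have C0 : 0 <= C by apply: sumr_ge0.
(* The extra factor [n] avoids the exponent [k - 1], which makes no sense for [k = 0]. *)
have h (n : nat) : (0 < n)%N -> n%:R * p.[n%:R] <= n%:R ^+ k * (p`_k * n%:R + C).
  move=> n0; have n1 : 1 <= n%:R :> rat by rewrite ler1n.
  rewrite (horner_coef_wide _ sp) big_ord_recr /= !mulrDr addrC.
  rewrite [X in _ <= X + _]mulrCA -exprSr mulrCA -exprS lerD2l !mulr_sumr.
  apply: ler_sum => i _; rewrite mulrCA -exprS [X in _ <= X]mulrC.
  apply: (le_trans (ler_norm _)); rewrite normrM normrX (@ger0_norm _ n%:R) //.
  by rewrite ler_wpM2l // ler_weXn2l.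
pose b := Num.bound (C / - p`_k).
pose n := maxn b (maxn N 1).
have n0 : (0 < n)%N by rewrite /n; lia.
have bn : C / - p`_k < n%:R.
  apply: lt_le_trans (archi_boundP _) _; first by rewrite divr_ge0 // oppr_ge0 ltW.
  by rewrite ler_nat /n; lia.
have neg : p`_k * n%:R + C < 0.
  by move: bn; rewrite ltr_pdivrMr ?oppr_gt0 // mulrN mulrC; lra.
have := h n n0; rewrite leNgt => /negP; apply.
apply: (@lt_le_trans _ _ 0).
  by rewrite pmulr_rlt0 // exprn_gt0 // ltr0n.
by rewrite mulr_ge0 // p0 // /n; lia.
Qed.

(* [c] is the coefficient of degree [k], possibly zero, so that growths of
   different degrees can be added. *)
Definition growth u k (c : rat) := exists p, [/\ (size p <= k.+1)%N, p`_k = c &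
  exists N, forall n, (N <= n)%N -> u n = p.[n%:R]].

Lemma growth_ge0 u k c N : growth u k c -> (forall n, (N <= n)%N -> 0 <= u n) -> 0 <= c.
Proof.
move=> [p [sp <- [N' up]]] u0; apply: (@coef_ge0 _ _ (maxn N N')) => // n.
by rewrite geq_max => /andP[Nn N'n]; rewrite -up //; apply: u0.
Qed.

Lemma growth_ext u v k c N : (forall n, (N <= n)%N -> u n = v n) ->
  growth v k c -> growth u k c.
Proof.
move=> uv [p [sp pk [N' vp]]]; exists p; split=> //; exists (maxn N N') => n.
by rewrite geq_max => /andP[Nn N'n]; rewrite uv // vp.
Qed.

Lemma growth_lift u k c : growth u k c -> growth u k.+1 0.
Proof.
by move=> [p [sp pk [N up]]]; exists p; split; [exact: leqW|rewrite nth_default|exists N].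
Qed.

Lemma growthD u v k a b : growth u k a -> growth v k b ->
  growth (fun n => u n + v n) k (a + b).
Proof.
move=> [p [sp <- [N up]]] [q [sq <- [N' vq]]]; exists (p + q).
split; [|by rewrite coefD|exists (maxn N N') => n].
  by apply: leq_trans (size_polyD _ _) _; rewrite geq_max sp.
by rewrite geq_max => /andP[Nn N'n]; rewrite hornerD up // vq.
Qed.

Lemma growthZ u k a c : growth u k c -> growth (fun n => a * u n) k (a * c).
Proof.
move=> [p [sp <- [N up]]]; exists (a *: p); split; [|by rewrite coefZ|].
  exact: leq_trans (size_scale_leq _ _) sp.
by exists N => n Nn; rewrite hornerZ up.
Qed.

Lemma growth_sum t (u : nat -> nat -> rat) k (c : nat -> rat) :
    (forall j, growth (u j) k (c j)) ->
  growth (fun n => \sum_(j < t) u j n) k (\sum_(j < t) c j).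
Proof.
move=> uc; elim: t => [|t IH].
  rewrite big_ord0; exists 0; rewrite size_poly0 coef0; split=> //.
  by exists 0%N => n _; rewrite big_ord0 horner0.
rewrite big_ord_recr /=; apply: (growth_ext (N := 0%N) _ (growthD IH (uc t))) => n _.
by rewrite big_ord_recr.
Qed.

(** Composition with the monic polynomial ['X - j] preserves the top coefficient; truncated
    subtraction is genuine once [n] is at least [N + j]. *)
Lemma growth_shift u k c j : growth u k c -> growth (fun n => u (n - j)%N) k c.
Proof.
move=> [p [sp <- [N up]]]; set q : {poly rat} := 'X - (j%:R)%:P.
have sq : size q = 2 by rewrite size_XsubC.
have spq : size (p \Po q) = size p by rewrite size_comp_poly2 // sq.
exists (p \Po q); split; rewrite ?spq //.
  move: sp; rewrite leq_eqVlt => /orP[/eqP sp|sp].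
    have := @lead_coef_comp _ p q; rewrite sq lead_coefXsubC expr1n mulr1.
    by rewrite /lead_coef spq sp; apply.
  by rewrite !nth_default // spq.
exists (N + j)%N => n Nn; rewrite up; last by lia.
by rewrite horner_comp /q !hornerE natrB //; lia.
Qed.

(** k! C(n+k, k) = (n+1)...(n+k) is monic of degree [k] in [n]. *)
Lemma growth_bin k : growth (fun n => ('C(n + k, k))%:R) k (k`!%:R)^-1.
Proof.
pose p : {poly rat} := \prod_(i < k) ('X - (- (i.+1)%:R)%:P).
have sp : size p = k.+1 by rewrite size_prod_XsubC /index_enum -enumT size_enum_ord.
exists ((k`!%:R)^-1 *: p); split.
- exact: leq_trans (size_scale_leq _ _) (eq_leq sp).
- have : p \is monic by apply: monic_prod_XsubC.
  by rewrite coefZ monicE /lead_coef sp => /eqP ->; rewrite mulr1.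
- exists 0%N => n _; rewrite hornerZ horner_prod.
  have k0 : k`!%:R != 0 :> rat by rewrite pnatr_eq0 -lt0n fact_gt0.
  apply: (mulIf k0); rewrite -natrM bin_ffact mulrAC mulVf // mul1r.
  elim: k {p sp k0} => [|k IH]; first by rewrite ffactn0 big_ord0.
  rewrite big_ord_recr /= -IH !hornerE addnS ffactSS natrM mulrC opprK.
  by rewrite -natrD addnS.
Qed.

Definition hilbert_poly (d : nat) (e : nat -> rat) (n : nat) : rat :=
  \sum_(i < d.+1) (-1) ^+ i * e i * ('C(n + d - i, d - i))%:R.

(** Once [e 0] vanishes, this exposes [- e 1] as the coefficient governing growth of degree [d]. *)
Lemma hilbert_polyS d e n : hilbert_poly d.+1 e n =
  e 0%N * ('C(n + d.+1, d.+1))%:R + hilbert_poly d (fun i => - e i.+1) n.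
Proof.
rewrite /hilbert_poly big_ord_recl /= !subn0 expr0 mul1r; congr (_ + _).
apply: eq_bigr => i _; rewrite /bump /= add1n addnS !subSS exprS.
by congr (_ * _); rewrite mulN1r mulNr mulrN.
Qed.

Lemma growth_hilbert_poly d e : growth (hilbert_poly d e) d (e 0%N / d`!%:R).
Proof.
elim: d e => [|d IH] e.
  apply: (growth_ext (N := 0%N) _ (growthZ (e 0%N) (growth_bin 0))) => n _.
  by rewrite /hilbert_poly big_ord1 expr0 mul1r addn0 subn0.
rewrite -[_ / _]addr0.
apply: (growth_ext (N := 0%N) _
  (growthD (growthZ (e 0%N) (growth_bin d.+1)) (growth_lift (IH _)))).
by move=> n _; rewrite hilbert_polyS.
Qed.

End Growth.

(** * Comparison of the coefficients of n^d and n^(d-1) *)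

Theorem theorem2p6 (R : comUnitRingType) (mm : R -> Prop) (d : nat)
  (J : R -> Prop) (m : nat) (h : 'I_m -> R)
  (eI eJ : nat -> int) (f0 s l : nat) :
  noetherian R -> local_ring mm -> krull_dim R d -> (1 <= d)%N ->
  primary_to mm J ->
  (forall i, integral_over J (h i)) ->
  red_number J (adjoin J h) s ->
  hilbert_coeffs d (adjoin J h) eI ->
  hilbert_coeffs d J eJ ->
  fiber_mult d J f0 ->
  length_quot (colon J (adjoin J h)) l ->
  eI 1%N - eJ 1%N <= l%:Z * (('C(m + s, s))%:Z - 1) * f0%:Z.
Proof.
move=> _ _ _ + [idJ _] _ [red _] HI HJ [p [sp [Nf Hf]]] [_ hl].
(* From here the dimension is [d.+1], so [p] has degree below [d]. *)
case: d sp Hf HI HJ => // d /= sp Hf HI HJ _.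
have /choice[nu nuP] n : exists k, (Nf <= n)%N -> gen_by (powI J n) k /\
    k%:R = f0%:R * ('C(n + d, d))%:R + p.[n%:R] :> rat.
  by case: (leqP Nf n) => [/Hf[k [[gk _] ek]]|_]; [exists k|exists 0%N].
set hs := [seq h i | i <- enum 'I_m].
(* The exponent is [n.+1] because [hilbert_coeffs] measures R/K^(n+1). *)
pose bound n := (\sum_(j < s) nu (n.+1 - j.+1) * size (monomials hs j.+1))%N.
pose del i : rat := (eJ i)%:~R - (eI i)%:~R.
have [N delP] : exists N, forall n, (N <= n)%N ->
    0 <= hilbert_poly d.+1 del n <= l%:R * (bound n)%:R.
  case: HI => NI HI; case: HJ => NJ HJ.
  (* The term [s + Nf] keeps every exponent from [n.+1 - s] on in the range where [nu] counts
     generators. *)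
  exists (maxn (maxn NI NJ) (s + Nf)) => n.
  rewrite !geq_max => /andP[/andP[/HI[lI [hI eqI]] /HJ[lJ [hJ eqJ]]] nn].
  have -> : hilbert_poly d.+1 del n = lJ%:R - lI%:R.
    have toR (x : nat) : x%:R = (x%:Z)%:~R :> rat by [].
    rewrite (toR lJ) (toR lI) eqI eqJ !rmorph_sum -sumrB; apply: eq_bigr => i _ /=.
    by rewrite !rmorphM !rmorphXn rmorphN1 /= /del mulrBr mulrBl.
  have := @length_powI_adjoin_le _ _ _ h idJ l s n.+1 lI lJ nu hl.
  case/(_ _ _ _ hI hJ)/andP; [by move=> x /red|by lia| |].
    by move=> b nb; apply nuP; lia.
  rewrite subr_ge0 ler_nat => -> lB /=.
  by rewrite lerBlDl -natrM -natrD ler_nat.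
have nu_growth : growth (fun n => (nu n)%:R) d (f0%:R / d`!%:R).
  rewrite -[_ / _]addr0; apply: (growth_ext (N := Nf) _
    (growthD (growthZ f0%:R (growth_bin d)) (_ : growth (fun n => p.[n%:R]) d 0))).
    by move=> n /nuP[].
  by exists p; split; [exact: leqW|rewrite nth_default|exists 0%N].
pose M : rat := ('C(m + s, s))%:R - 1.
have bound_growth : growth (fun n => l%:R * (bound n)%:R) d (l%:R * (M * (f0%:R / d`!%:R))).
  apply: growthZ.
  have -> : M * (f0%:R / d`!%:R) =
      \sum_(j < s) (size (monomials hs j.+1))%:R * (f0%:R / d`!%:R).
    rewrite -mulr_suml; congr (_ * _); rewrite /M.
    (* The single monomial of degree 0 accounts for the [- 1] in [M]. *)
    have -> : m = size hs by rewrite size_map size_enum_ord.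
    by rewrite -size_monomials_sum big_ord_recl monomials0 natrD addrC addKr natr_sum.
  apply: (growth_ext (N := 0%N) _ (growth_sum s
    (fun j => growthZ (size (monomials hs j.+1))%:R (growth_shift j nu_growth)))) => n _.
  by rewrite /bound natr_sum; apply: eq_bigr => j _; rewrite natrM mulrC subSS.
have del_growth := growth_hilbert_poly d.+1 del.
have fact_pos k : 0 < (k`!%:R)^-1 :> rat by rewrite invr_gt0 ltr0n fact_gt0.
(* The difference has degree at most [d.+1] but lies between 0 and a function of degree at most [d],
   so its coefficient of degree [d.+1] is both nonnegative and nonpositive. *)
have del0 : del 0%N = 0.
  apply/eqP; rewrite eq_le; apply/andP; split.
    have := growthD (growth_lift bound_growth) (growthZ (-1) del_growth).
    move/(growth_ge0 (N := N)); rewrite add0r mulN1r oppr_ge0 pmulr_lle0 //; apply.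
    by move=> n /delP/andP[_]; rewrite mulN1r subr_ge0.
  have := growth_ge0 del_growth (N := N); rewrite pmulr_lge0 //; apply.
  by move=> n /delP/andP[].
(* With [del 0 = 0] the difference drops to degree [d], where its coefficient is [- del 1 / d!],
   that is (e_1(I) - e_1(J)) / d!. *)
have : 0 <= l%:R * (M * (f0%:R / d`!%:R)) + -1 * (- del 1%N / d`!%:R).
  apply: (growth_ge0 (N := N) (growthD bound_growth (growthZ (-1)
    (growth_hilbert_poly d (fun i => - del i.+1))))) => n /delP/andP[_].
  by rewrite hilbert_polyS del0 mul0r add0r mulN1r subr_ge0.
rewrite mulN1r mulNr opprK !mulrA -mulrDl pmulr_lge0 // => le1.
rewrite -(ler_int rat) !(rmorphM, rmorphB) /= -subr_ge0.
by move: le1; rewrite /M /del rmorph1; congr (0 <= _); ring.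
Qed.
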